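(* Let $G$ be a graph, let $k\geq 3$ be an integer and let $(T,\chi)$ be a $k$-atomic tree decomposition of $G$. Let $t\in V(T)$. If $u,v\in\chi(t)$ are non-adjacent vertices, each of degree at least $(2k-2)(k-2)$ in the torso $\hat\chi(t)$, then there are $k$ pairwise internally vertex-disjoint paths in $G$ from $u$ to $v$.
   Context: For a tree decomposition $(T,\chi)$ of $G$ and an edge $uv\in E(T)$, the adhesion at $uv$ is $\chi(u)\cap\chi(v)$; $adh(T,\chi)$ is $0$ if $E(T)=\emptyset$ and the maximum adhesion size over all edges of $T$ otherwise. The torso $\hat\chi(x)$ at $x\in V(T)$ is the graph obtained from $G[\chi(x)]$ by adding, for each $y\in N_T(x)$, an edge between every two non-adjacent vertices of $\chi(x)\cap\chi(y)$. For an $n$-vertex graph $G$, the fatness of a tree decomposition is the vector $(a_n,\dots,a_0)$, where $a_i$ is the number of bags of size $i$. A tree decomposition is $k$-atomic if its adhesion is less than $k$ and its fatness is lexicographically minimum among all tree decompositions of $G$ with adhesion less than $k$. *)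

(* Defs.v *)
From HB Require Import structures.
From mathcomp Require Import all_boot all_order.
Set Implicit Arguments.
Unset Strict Implicit.
Unset Printing Implicit Defensive.

Record sgraph := SGraph {
  vertex :> finType;
  edge : rel vertex;
  edge_sym : symmetric edge;
  edge_irr : irreflexive edge
}.

Definition degree (V : finType) (e : rel V) (u : V) : nat :=
  #|[set w | e u w]|.

Definition induced (V : finType) (e : rel V) (S : {set V}) : rel V :=
  [rel x y | [&& x \in S, y \in S & e x y]].

Definition connected_on (V : finType) (e : rel V) (S : {set V}) : Prop :=
  {in S &, forall x y, connect (induced e S) x y}.

(* [ucycle] also holds of [:: x; y] for an edge xy, hence the length bound. *)
Definition acyclic (V : finType) (e : rel V) : Prop :=
  forall c : seq V, 2 < size c -> ~ ucycle e c.

Definition is_tree (T : sgraph) : Prop :=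
  [/\ 0 < #|T|, connected_on (@edge T) [set: T] & acyclic (@edge T)].

Record tree_decomposition (G : sgraph) := TreeDecomposition {
  tree : sgraph;
  treeP : is_tree tree;
  bag : tree -> {set G};
  bag_vertex : forall v : G, exists x, v \in bag x;
  bag_edge : forall u v : G, edge u v -> exists x, u \in bag x /\ v \in bag x;
  bag_connected : forall v : G,
    connected_on (@edge tree) [set x | v \in bag x]
}.

Section TreeDecompositions.
Variable G : sgraph.
Implicit Type D : tree_decomposition G.

(* The empty maximum is 0, as required when the tree has no edge. *)
Definition adh D : nat :=
  \max_(p : tree D * tree D | edge p.1 p.2) #|bag p.1 :&: bag p.2|.

(* The torso has vertex set [bag x]; it is given as a relation on G in which
   the vertices outside the bag are isolated. *)
Definition torso D (x : tree D) : rel G :=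
  [rel u v | [&& u \in bag x, v \in bag x, u != v &
     edge u v || [exists y, [&& edge x y, u \in bag y & v \in bag y]]]].

(* The list a_n, ..., a_0 (n = #|G|), in the lexicographically ordered alias
   of [seq nat]. *)
Definition fatness D : seqlexi nat :=
  [seq #|[set x : tree D | #|bag x| == i]| | i <- rev (iota 0 #|G|.+1)].

Definition atomic (k : nat) D : Prop :=
  adh D < k /\
  forall D', adh D' < k -> (fatness D <= fatness D')%O.

End TreeDecompositions.

(* The path is u :: p, with p ending at v. *)
Definition is_path (V : finType) (e : rel V) (u v : V) (p : seq V) : Prop :=
  [/\ path e u p, last u p = v & uniq (u :: p)].

Definition interior (V : finType) (u v : V) (p : seq V) : {set V} :=
  [set x in u :: p | (x != u) && (x != v)].

Definition has_disjoint_paths (V : finType) (e : rel V) (k : nat) (u v : V) :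
    Prop :=
  exists P : 'I_k -> seq V,
    [/\ forall i, is_path e u v (P i),
        injective P &
        forall i j, i != j ->
          [disjoint interior u v (P i) & interior u v (P j)]].

(* Main.v *)
Require Import Defs.
From mathcomp Require Import all_boot all_order.
From mathcomp Require Import zify.

(** Suppose that u and v are not joined by k disjoint paths. By Menger's theorem
    some separation (A, B) of order less than k separates them.

    Root the tree at t.  The bag of t is lean: A or B contains fewer than k of its
    vertices.  Otherwise choose a separation of order less than k with at least k
    vertices of the bag on both sides, first of minimum order, then with its
    separator S as close to t as possible (Bellenbaum-Diestel).  Take two copies
    of the tree joined at t; in the first copy the bag X of y becomes X - B
    together with the vertices of S lying in bags below y, and symmetrically in
    the second.  Exchanging the part of S below y for the part of the adhesion
    set above y in B gives again such a separation, so minimality shows that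
    neither adhesion nor bags grow, and that when a copy keeps the size of its
    bag the other copy has fewer than k vertices.  The bag of t shrinks in both
    copies, which contradicts the minimality of the fatness.

    Say A contains fewer than k vertices of the bag of t.  A torso neighbour of u
    outside A shares with u an adhesion set of t, and S must meet the interior of
    that branch, since otherwise the branch could be split along (A, B).  Branches
    have disjoint interiors, so u has torso degree at most
    (k - 2) + (k - 1)(k - 2) < (2k - 2)(k - 2). *)

Set Implicit Arguments.
Unset Strict Implicit.
Unset Printing Implicit Defensive.

(** * Connectivity in relations on finite types *)

Lemma connect_crossing (V : finType) (r : rel V) (P : pred V) x y :
  connect r x y -> P x -> ~~ P y -> exists a b, [/\ r a b, P a & ~~ P b].
Proof.
case/connectP=> p; elim: p x => [|z p IHp] x /=.
  by move=> _ -> Px; rewrite Px.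
case/andP=> rxz pz yE Px nPy.
by case: (boolP (P z)) => Pz; [apply: IHp pz yE Pz nPy | exists x, z].
Qed.

Lemma connect_induced_sym (V : finType) (e : rel V) (X : {set V}) :
  symmetric e -> connect_sym (induced e X).
Proof.
by move=> eC; apply: sym_connect_sym => x y; rewrite /induced /= eC andbCA.
Qed.

(** * Rooted trees *)

Section RootedTrees.
Variables (V : finType) (e : rel V) (t : V) (par : V -> V) (d : V -> nat).

Definition rooted : Prop :=
  [/\ par t = t,
      forall y, y != t -> e y (par y),
      forall y, y != t -> d (par y) < d y
    & forall y z, e y z -> (y != t /\ par y = z) \/ (z != t /\ par z = y)].

Definition ancestor (y z : V) : bool := fconnect par z y.

Hypothesis rt : rooted.

Lemma ancestor_refl y : ancestor y y.
Proof. exact: connect0. Qed.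

Lemma ancestor_trans x y z : ancestor x y -> ancestor y z -> ancestor x z.
Proof. by move=> xy yz; apply: connect_trans yz xy. Qed.

Lemma ancestor_par y z : ancestor y (par z) -> ancestor y z.
Proof. by apply: connect_trans; apply: fconnect1. Qed.

Lemma ancestor_root z : ancestor t z.
Proof.
case: rt => _ _ dP _; elim/(@ltn_ind): {z}(d z) {-2}z (leqnn (d z)) => n IHn z dz.
case: (eqVneq z t) => [->|zt]; first exact: ancestor_refl.
by apply: ancestor_par; apply: IHn (leqnn _); apply: leq_trans dz; apply: dP.
Qed.

Lemma not_ancestor_root y : y != t -> ~~ ancestor y t.
Proof.
case: rt => pt _ _ _; apply: contraNN => /iter_findex <-.
by elim: (findex _ _ _) => //= n /eqP ->; rewrite pt.
Qed.

Lemma ancestor_parW y z : ancestor y z -> z != y -> ancestor y (par z).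
Proof.
move=> /iter_findex <-; case: (findex _ _ _) => [|n]; first by rewrite eqxx.
by rewrite iterSr => _; apply: fconnect_iter.
Qed.

(** Every edge joins a node to its parent: going down stays in the subtree below [y], and going up
    leaves it only from its top. *)
Lemma ancestor_cross y z z' :
  e z z' -> ancestor y z -> ~~ ancestor y z' -> z = y /\ z' = par y.
Proof.
case: rt => _ _ _ eP /eP[[zt pz]|[zt pz]] yz nyz'; last first.
  by case/negP: nyz'; apply: ancestor_par; rewrite pz.
case: (eqVneq z y) => [<-|zy]; first by rewrite pz.
by case/negP: nyz'; rewrite -pz; apply: ancestor_parW.
Qed.

(** Branches at the root are disjoint: [y] and [y'] both lie on the [par]-orbit of [z], and after
    the first of them the orbit is at [t] forever. *)
Lemma ancestor_children y y' z :
  y != t -> y' != t -> par y = t -> par y' = t ->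
  ancestor y z -> ancestor y' z -> y = y'.
Proof.
move=> yt y't py py' yz y'z; apply/eqP.
have [pt _ _ _] := rt.
wlog le_yy' : y y' yt y't py py' yz y'z /
    findex par z y <= findex par z y'.
  move=> W; case/orP: (leq_total (findex par z y) (findex par z y')) => le.
    exact: W.
  by rewrite eq_sym; apply: W.
move: y't; rewrite -{1 2}(iter_findex y'z) -(subnK le_yy') iterD iter_findex //.
case: (_ - _) => [|n]; first by rewrite /= eqxx.
by rewrite iterSr py; elim: n => [|n IHn] /=; rewrite ?eqxx // -iterS iterSr pt.
Qed.

Lemma connected_on_par (X : {set V}) (r : V) : symmetric e -> r \in X ->
  (forall z, z \in X -> z != r -> z != t /\ par z \in X) ->
  connected_on e X.
Proof.
case: rt => _ ePar dP _ eC rX XP.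
have toR z : z \in X -> connect (induced e X) z r.
  elim/(@ltn_ind): {z}(d z) {-2}z (leqnn (d z)) => n IHn z dz zX.
  case: (eqVneq z r) => [->|zr]; first exact: connect0.
  have [zt pX] := XP z zX zr.
  apply: (@connect_trans _ _ (par z)).
    by apply: connect1; rewrite /induced /= zX pX ePar.
  by apply: IHn (leqnn _) pX; apply: leq_trans dz; apply: dP.
move=> x y xX yX; apply: connect_trans (toR x xX) _.
by rewrite connect_induced_sym // toR.
Qed.

(* The two neighbours on a cycle of a deepest vertex would both be its parent. *)
Lemma rooted_acyclic : acyclic e.
Proof.
case: rt => _ _ dP eP c sz /andP[cyc uc].
have [x0 x0c] : exists x, x \in c by case: (c) sz => // x s; exists x; rewrite mem_head.
case: (@arg_maxnP _ x0 (mem c) d x0c) => x xc xmax.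
have parE y : y \in c -> e x y || e y x -> par x = y.
  move=> yc; have le : ~ (d x < d y).
    by move: (xmax _ yc) => /=; lia.
  case/orP=> /eP[[nt pE]|[nt pE]] //; case: le; rewrite -pE; exact: dP.
case: (rot_to xc) => i s rE.
have mem_s y : y \in x :: s -> y \in c by rewrite -rE mem_rot.
move: sz uc cyc; rewrite -(size_rot i) -(rot_uniq i) -(rot_cycle i) rE.
case: s {rE} mem_s => [|y s] //= mem_s.
rewrite rcons_path /=; case: s mem_s => // z s mem_s _ /andP[_ /andP[ynz _]].
case/and3P=> exy _ elx.
have E1 : par x = y by apply: parE; rewrite ?exy // mem_s // !inE eqxx orbT.
have E2 : par x = last z s.
  by apply: parE; rewrite ?elx ?orbT // mem_s // 2!in_cons mem_last !orbT.
by move: ynz; rewrite -E1 E2 mem_last.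
Qed.

Lemma rooted_connected : symmetric e -> connected_on e [set: V].
Proof.
by move=> eC; apply: (@connected_on_par _ t eC) => [|z _ zt]; rewrite ?inE.
Qed.

End RootedTrees.

(** Here [d] is the distance to [t] and the parent is a strictly nearer neighbour; acyclicity makes
    it the only neighbour that is not farther from [t] than the node itself. *)
Lemma tree_rooted (T : sgraph) (t : T) : is_tree T ->
  exists par d, rooted (@edge T) t par d.
Proof.
move=> [_ conn acyc]; have eC := @edge_sym T.
pose reach y n := [exists p : n.-tuple T, path (@edge T) y p && (last y p == t)].
have reachP y n p : path (@edge T) y p -> last y p = t -> size p = n -> reach y n.
  move=> yp lt /eqP sz; apply/existsP; exists (Tuple sz) => /=.
  by rewrite yp lt eqxx.
have ex y : exists n, reach y n.
  have /connectP[p yp tE] := conn y t (in_setT _) (in_setT _).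
  exists (size p); apply: (reachP y _ p) => //.
  by apply: sub_path yp => a b /and3P[].
pose d y := ex_minn (ex y).
have dle y n : reach y n -> d y <= n by rewrite /d; case: ex_minnP => m _; apply.
have d_reach y : reach y (d y) by rewrite /d; case: ex_minnP.
have lower y : y != t -> exists z, edge y z && (d z < d y).
  move=> yt; have /existsP[p /andP[yp /eqP lt]] := d_reach y.
  case: p yp lt => [[|z p] /= sz]; first by move=> _ E; rewrite E eqxx in yt.
  case/andP=> yz zp lt; exists z; rewrite yz -(eqP sz).
  by apply: dle; apply: reachP zp lt _.
(* Each step goes strictly nearer to [t], so it cannot reach [y]. *)
have descend y z : z != y -> d z <= d y ->
    connect (induced (@edge T) [set~ y]) z t.
  elim/(@ltn_ind): {z}(d z) {-2}z (leqnn (d z)) => n IHn z dz zy dzy.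
  case: (eqVneq z t) => [->|zt]; first exact: connect0.
  have [z1 /andP[ez lt]] := lower _ zt.
  have z1y : z1 != y by apply: contraTneq lt => ->; rewrite -leqNgt.
  apply: (@connect_trans _ _ z1).
    by apply: connect1; rewrite /induced /= !inE zy z1y ez.
  by apply: (IHn (d z1)) => //; lia.
(* Two such neighbours would be joined by a path avoiding [y], which closes a cycle through [y].
   Allowing equal depths also excludes edges within a level. *)
have uniq_par y z z' : edge y z -> edge y z' -> d z <= d y -> d z' <= d y -> z = z'.
  move=> yz yz' dz dz'; apply/eqP; apply/negPn/negP => zz'.
  have ney w : edge y w -> w != y.
    by move=> yw; apply: contraTneq yw => ->; rewrite edge_irr.
  have /connectP[p0 zp0 lE0] : connect (induced (@edge T) [set~ y]) z z'.
    apply: connect_trans (descend y z (ney _ yz) dz) _.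
    by rewrite connect_induced_sym // descend // ney.
  move: lE0; case: (shortenP zp0) => p zp up _ lE {p0 zp0}.
  apply: (acyc (y :: z :: p)); first by case: (p) lE zz' => //= ->; rewrite eqxx.
  have zpe : path (@edge T) z p by apply: sub_path zp => a b /and3P[].
  have yp : y \notin p.
    elim: (p) {up lE zpe} z zp {yz dz zz'} => //= a q IHq b /andP[/and3P[_ + _] bq].
    by rewrite !inE eq_sym => /negPf ->; apply: IHq bq.
  rewrite /ucycle /= rcons_path yz zpe -lE eC yz' inE negb_or yp /=.
  by rewrite eq_sym ney.
pose par y := if y == t then t else odflt t [pick z | edge y z && (d z < d y)].
have parP y : y != t -> edge y (par y) && (d (par y) < d y).
  move=> yt; rewrite /par (negPf yt); case: pickP => //= none.
  by have [z] := lower _ yt; rewrite none.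
exists par, d; split.
- by rewrite /par eqxx.
- by move=> y /parP/andP[].
- by move=> y /parP/andP[].
have rootd z : edge t z -> ~ (d z <= d t).
  move=> tz; have dt : d t = 0.
    by apply/eqP; rewrite -leqn0; apply: dle; apply: (reachP _ _ [::]).
  rewrite dt leqn0 => /eqP dz; have := d_reach z; rewrite dz.
  case/existsP=> p; rewrite tuple0 /= => /eqP zt.
  by rewrite zt edge_irr in tz.
have main y z : edge y z -> d z <= d y -> y != t /\ par y = z.
  move=> yz dz; have yt : y != t by apply/eqP => yt; apply: (rootd z); rewrite -yt.
  by have /andP[e1 /ltnW d1] := parP y yt; split=> //; apply: uniq_par e1 yz d1 dz.
move=> y z yz; case/orP: (leq_total (d z) (d y)) => le.
  by left; apply: main.
by right; apply: main; rewrite // eC.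
Qed.

(** * Tree decompositions from parent maps *)

(** Connectedness takes the form of a top node [b] to which the nodes holding [v] climb, and
    adhesion is checked only between a node and its parent. *)
Lemma rooted_decomposition (G : sgraph) (k : nat) (V : finType) (r : V)
    (par : V -> V) (d : V -> nat) (F : V -> {set G}) :
  0 < k -> par r = r -> (forall a, a != r -> d (par a) < d a) ->
  (forall v, exists a, v \in F a) ->
  (forall v w, edge v w -> exists a, v \in F a /\ w \in F a) ->
  (forall v, exists2 b, v \in F b & forall a, v \in F a -> a != b ->
     a != r /\ v \in F (par a)) ->
  (forall a, a != r -> #|F a :&: F (par a)| < k) ->
  exists2 D' : tree_decomposition G, adh D' < k
    & fatness D' = [seq #|[set a | #|F a| == i]| | i <- rev (iota 0 #|G|.+1)].
Proof.
move=> k0 pr dP cover edges conn adhF.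
pose e := [rel a b | (a != r) && (par a == b) || (b != r) && (par b == a)].
have eC : symmetric e by move=> a b; rewrite /= orbC.
have eI : irreflexive e.
  move=> a; rewrite /= orbb; apply/negP => /andP[ar /eqP pE].
  by have := dP a ar; rewrite pE ltnn.
pose T := SGraph eC eI.
have rt : rooted (@edge T) r par d.
  split=> // [y yr|y z /orP[/andP[yr /eqP]|/andP[zr /eqP]]]; last 2 first.
  - by left.
  - by right.
  by rewrite /= yr eqxx.
have tT : is_tree T.
  split; [by apply/card_gt0P; exists r | exact: rooted_connected rt eC |].
  exact: rooted_acyclic rt.
have bc v : connected_on (@edge T) [set a | v \in F a].
  have [b vb bP] := conn v.
  apply: (connected_on_par (r := b) rt eC); first by rewrite inE.
  by move=> z; rewrite !inE; apply: bP.
exists (@TreeDecomposition G T tT F cover edges bc) => //.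
rewrite /adh -(prednK k0) ltnS; apply/bigmax_leqP => -[a b] /= ab.
rewrite -ltnS prednK //.
case/orP: ab => /andP[nr /eqP <-]; first exact: adhF.
by rewrite setIC; apply: adhF.
Qed.

(** * Comparing fatness *)

(** The first index at which the two lists differ is [m] or lies in [s1], and there [b] is the
    smaller one. *)
Lemma seqlexi_nle_first_drop (a b : nat -> nat) (m : nat) (s1 s2 : seq nat) :
  (forall i, i \in s1 -> b i <= a i) -> b m < a m ->
  ~ ((map a (s1 ++ m :: s2) : seqlexi nat) <= map b (s1 ++ m :: s2))%O.
Proof.
move=> ba lt; elim: s1 ba => [|i s1 IHs] ba;
  rewrite /= Order.SeqLexiOrder.Exports.lexi_cons !leEnat.
  by rewrite leqNgt lt.
rewrite (ba i (mem_head _ _)) /= => /andP[_]; apply: IHs => j js.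
by apply: ba; rewrite inE js orbT.
Qed.

(** Here [w] stands for the old bag sizes, [f] and [g] for those of the two copies. If the copies of
    a node are not both smaller, one of them is below [c], so at sizes from [c] on the node counts
    no more than before. *)
Lemma fatness_copies_drop (V : finType) (n c : nat) (w : V -> nat)
    (f g : V -> nat) (y : V) :
  (forall z, w z <= n) ->
  (forall z, [\/ f z < w z /\ g z < w z, f z <= w z /\ g z < c
               | f z < c /\ g z <= w z]) ->
  c <= w y -> f y < w y -> g y < w y ->
  ~ (([seq #|[set z | w z == i]| | i <- rev (iota 0 n.+1)] : seqlexi nat)
     <= [seq #|[set a : V + V | (match a with inl z => f z | inr z => g z end) == i]|
        | i <- rev (iota 0 n.+1)])%O.
Proof.
move=> wn fgw cy fy gy.
pose broken z := (f z < w z) && (g z < w z).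
have by_ : broken y by rewrite /broken fy gy.
(* Above the largest weight [m] of a node both of whose copies are smaller, the
   counts do not increase, and at [m] they drop. *)
have [x bx xmax] := arg_maxnP w by_; set m := w x.
have cm : c <= m by apply: leq_trans cy (xmax y by_).
have cntE i : #|[set a : V + V | (match a with inl z => f z | inr z => g z end) == i]|
    = \sum_(z : V) ((f z == i) + (g z == i)).
  rewrite -sum1_card big_mkcond big_sumType big_split /=.
  by congr (_ + _); apply: eq_bigr => z _; rewrite inE; case: eqP.
have cntwE i : #|[set z | w z == i]| = \sum_(z : V) (w z == i : nat).
  by rewrite -sum1_card big_mkcond; apply: eq_bigr => z _; rewrite inE; case: eqP.
have pointwise i z : m <= i -> (f z == i) + (g z == i) <= (w z == i).
  move=> mi; case: (boolP (broken z)) => bz.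
    have := xmax z bz; case/andP: bz => ? ?; rewrite -/m => /= ?.
    by case: (f z =P i); case: (g z =P i); case: (w z =P i); lia.
  move: bz; rewrite /broken => bz.
  case: (fgw z) => -[? ?];
    by case: (f z =P i); case: (g z =P i); case: (w z =P i); lia.
have -> : rev (iota 0 n.+1) = rev (iota m.+1 (n - m)) ++ m :: rev (iota 0 m).
  have -> : n.+1 = m + (n - m).+1 by have := wn x; rewrite -/m; lia.
  by rewrite iotaD rev_cat /= rev_cons cat_rcons.
apply: seqlexi_nle_first_drop => [i|].
  rewrite mem_rev mem_iota => /andP[/ltnW mi _].
  by rewrite cntE cntwE; apply: leq_sum => z _; apply: pointwise.
rewrite cntE cntwE [X in X < _](bigD1 x) //= [X in _ < X](bigD1 x) //=.
have/andP[fx gx] := bx.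
rewrite (ltn_eqF fx) (ltn_eqF gx) eqxx -ltnS ltnS add0n add1n ltnS.
by apply: leq_sum => z _; apply: pointwise.
Qed.

Lemma proper_subset_card (V : finType) (X Y : {set V}) x :
  X \subset Y -> x \in Y -> x \notin X -> #|X| < #|Y|.
Proof.
by move=> sXY xY xX; apply: proper_card; apply/properP; split=> //; exists x.
Qed.

(** The two differences have equal size, and every weight on [X :\: Y] exceeds the maximum [c] on
    [Y :\: X]. Were they nonempty, the sum over [X] would be the larger one. *)
Lemma subset_of_sum_leq (V : finType) (w : V -> nat) (X Y : {set V}) :
  #|X| = #|Y| -> (forall a b, a \in Y :\: X -> b \in X :\: Y -> w a < w b) ->
  \sum_(x in X) w x <= \sum_(x in Y) w x -> Y \subset X.
Proof.
move=> eXY lt; rewrite (big_setID Y) [X in _ <= X](big_setID X) /= setIC leq_add2l.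
have eD : #|X :\: Y| = #|Y :\: X|.
  by move: (cardsID Y X) (cardsID X Y); rewrite (setIC Y X); lia.
move=> le; rewrite -setD_eq0; apply/negPn/negP => /set0Pn[a0 a0P].
have Y0 : 0 < #|Y :\: X| by apply/card_gt0P; exists a0.
pose c := \max_(a in Y :\: X) w a.
have leY : \sum_(x in Y :\: X) w x <= #|Y :\: X| * c.
  by rewrite -sum_nat_const; apply: leq_sum => a aP; apply: leq_bigmax_cond.
have geX : #|X :\: Y| * c.+1 <= \sum_(x in X :\: Y) w x.
  rewrite -sum_nat_const; apply: leq_sum => b bP.
  by have [a aP cE] := eq_bigmax_cond w Y0; rewrite /c cE; apply: lt.
by rewrite eD in geX; nia.
Qed.

(** * Separations of a graph *)

(** The sides may overlap, in the separator [A :&: B]. The boolean form allows minimising over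
    separations with [arg_minnP]. *)
Definition separation (G : sgraph) (A B : {set G}) : bool :=
  (A :|: B == setT) && [forall a in A :\: B, forall b in B :\: A, ~~ edge a b].

Lemma separationP (G : sgraph) (A B : {set G}) :
  reflect ((forall v, v \in A \/ v \in B) /\
           (forall a b, a \in A -> a \notin B -> b \in B -> b \notin A ->
              ~~ edge a b))
          (separation A B).
Proof.
apply: (iffP andP) => -[].
  move=> /eqP cov /forall_inP sep; split.
    by move=> v; apply/orP; rewrite -in_setU cov inE.
  move=> a b aA aB bB bA; have aAB : a \in A :\: B by rewrite inE aA aB.
  by have /forall_inP := sep a aAB; apply; rewrite inE bA.
move=> cov sep; split.
  by apply/eqP/setP => v; rewrite !inE; apply/orP.
apply/forall_inP => a; rewrite inE => /andP[aB aA].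
by apply/forall_inP => b; rewrite inE => /andP[bA bB]; apply: sep.
Qed.

Lemma separation_sym (G : sgraph) (A B : {set G}) :
  separation A B = separation B A.
Proof.
suff imp : forall X Y : {set G}, separation X Y -> separation Y X.
  by apply/idP/idP => /imp.
move=> {}A {}B /separationP[cov sep]; apply/separationP; split.
  by move=> v; case: (cov v); [right | left].
by move=> a b ? ? ? ?; rewrite edge_sym; apply: sep.
Qed.

Lemma separation_edge (G : sgraph) (A B : {set G}) a b :
  separation A B -> edge a b ->
  (a \in A /\ b \in A) \/ (a \in B /\ b \in B).
Proof.
move=> /separationP[cov sep] ab; have ba : edge b a by rewrite edge_sym.
have := sep a b; have := sep b a; rewrite ab ba; have := cov a; have := cov b.
case: (a \in A); case: (b \in A); case: (a \in B); case: (b \in B);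
  by [auto | case | move=> _ [] | move=> _ _ /(_ isT isT isT isT)
     | move=> _ _ _ /(_ isT isT isT isT)].
Qed.

Section RootedDecomposition.
Variables (G : sgraph) (D : tree_decomposition G) (t : tree D).
Variables (par : tree D -> tree D) (d : tree D -> nat).
Hypothesis rt : rooted (@edge (tree D)) t par d.

(** * Two copies of the tree joined at the root *)

(** The second copy hangs by its own root [inr t] from the root [inl t] of the whole. *)
Definition double_par (a : tree D + tree D) : tree D + tree D :=
  match a with
  | inl z => inl (par z)
  | inr z => if z == t then inl t else inr (par z)
  end.

(** The threshold [c] is left free: it will be [k] for leanness at the root, and the size of [bag y]
    when the branch at [y] is split. *)
Lemma double_not_atomic (k c : nat) (F : tree D + tree D -> {set G})
    (y : tree D) : 0 < k ->
  (forall v, exists a, v \in F a) ->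
  (forall v w, edge v w -> exists a, v \in F a /\ w \in F a) ->
  (forall v, exists2 b, v \in F b & forall a, v \in F a -> a != b ->
     a != inl t /\ v \in F (double_par a)) ->
  (forall a, a != inl t -> #|F a :&: F (double_par a)| < k) ->
  (forall z, [\/ #|F (inl z)| < #|bag z| /\ #|F (inr z)| < #|bag z|,
                 #|F (inl z)| <= #|bag z| /\ #|F (inr z)| < c
               | #|F (inl z)| < c /\ #|F (inr z)| <= #|bag z|]) ->
  c <= #|bag y| -> #|F (inl y)| < #|bag y| -> #|F (inr y)| < #|bag y| ->
  ~ atomic k D.
Proof.
move=> k0 cover edges conn adhF sizes cy fy gy [_ fatmin].
have [pt _ dP _] := rt.
(* The shift by one puts [inr t] strictly below [inl t]. *)
pose dd a := match a with inl z => d z | inr z => (d z).+1 end.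
have [||D' adhD' fatD'] := @rooted_decomposition G k (tree D + tree D)%type (inl t)
  double_par dd F k0 _ _ cover edges conn adhF.
- by rewrite /= pt.
- case=> [z|z] /= zt; first by apply: dP; apply: contraNneq zt => ->.
  case: eqVneq => [->|zt']; first by rewrite /= ltnS.
  by rewrite /= ltnS dP.
have := fatmin D' adhD'; rewrite fatD'.
have wn (z : tree D) : #|bag z| <= #|G| by apply: max_card.
have := fatness_copies_drop wn sizes cy fy gy.
have eqL : [seq #|[set a | #|F a| == i]| | i <- rev (iota 0 #|G|.+1)] =
    [seq #|[set a | (match a with inl z => #|F (inl z)| | inr z => #|F (inr z)| end)
             == i]| | i <- rev (iota 0 #|G|.+1)].
  by apply: eq_map => i; congr #|pred_of_set _|; apply/setP => -[] z; rewrite !inE.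
by rewrite -eqL.
Qed.

(** * Vertices below and above a tree node *)

Definition below (y : tree D) : {set G} :=
  [set x | [exists z, ancestor par y z && (x \in bag z)]].

Definition above (y : tree D) : {set G} :=
  [set x | [exists z, ~~ ancestor par y z && (x \in bag z)]].

Lemma belowI y z x : ancestor par y z -> x \in bag z -> x \in below y.
Proof. by move=> yz xz; rewrite inE; apply/existsP; exists z; rewrite yz. Qed.

Lemma aboveI y z x : ~~ ancestor par y z -> x \in bag z -> x \in above y.
Proof. by move=> yz xz; rewrite inE; apply/existsP; exists z; rewrite yz. Qed.

Lemma bag_below y : bag y \subset below y.
Proof. by apply/subsetP => x; apply: belowI; apply: ancestor_refl. Qed.

Lemma bag_root_above y : y != t -> bag t \subset above y.
Proof. by move=> yt; apply/subsetP => x; apply: aboveI (not_ancestor_root rt yt). Qed.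

Lemma below_par y : below y \subset below (par y).
Proof.
apply/subsetP => x; rewrite inE => /existsP[z /andP[yz xz]].
by apply: belowI xz; apply: ancestor_trans yz; apply: fconnect1.
Qed.

Lemma below_root : below t = setT.
Proof.
apply/setP => x; rewrite !inE; have [z xz] := bag_vertex D x.
by apply/existsP; exists z; rewrite xz (ancestor_root rt).
Qed.

(** The nodes holding a given vertex are connected, so if they occur inside and outside the subtree
    below [y], they include both ends of its only exit edge. *)
Lemma below_above y : below y :&: above y \subset bag y :&: bag (par y).
Proof.
apply/subsetP => x; rewrite !inE.
case/andP=> /existsP[z /andP[yz xz]] /existsP[z' /andP[yz' xz']].
have zX : z \in [set z | x \in bag z] by rewrite inE.
have z'X : z' \in [set z | x \in bag z] by rewrite inE.
have [a [b [/and3P[]]]] := connect_crossing (bag_connected zX z'X) yz yz'.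
rewrite !inE => xa xb ab ya yb.
by have [<- <-] := ancestor_cross rt ab ya yb; rewrite xa xb.
Qed.

Lemma edge_below y a b : edge a b -> a \in below y -> b \notin below y ->
  a \in above y.
Proof.
move=> ab ay; apply: contraNT => nay; have [z [az bz]] := bag_edge D ab.
case: (boolP (ancestor par y z)) => yz; first exact: belowI bz.
by rewrite (aboveI yz az) in nay.
Qed.

(** * Exchanging a separation at a tree edge *)

(** Everything below [y] moves to the first side, and below [y] the second side keeps only its part
    of the adhesion set, written [below y :&: above y]. This trades the separator vertices below [y]
    for that part. *)
Definition exchangeA (A : {set G}) y := A :|: below y.
Definition exchangeB (B : {set G}) y :=
  (B :\: below y) :|: (below y :&: above y :&: B).

Lemma exchangeI A B y :
  exchangeA A y :&: exchangeB B y =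
  (A :&: B :\: below y) :|: (below y :&: above y :&: B).
Proof.
apply/setP => x; rewrite /exchangeA /exchangeB.
rewrite !(in_setI, in_setU, in_setD).
by case: (x \in A); case: (x \in B); case: (x \in below y); case: (x \in above y).
Qed.

(** An edge leaving [below y] starts in [above y]. If its start is outside [exchangeB B y], it is
    outside [B], so a crossing edge would already cross [(A, B)]. *)
Lemma exchange_separation A B y :
  separation A B -> separation (exchangeA A y) (exchangeB B y).
Proof.
move=> /separationP[cov sep]; apply/separationP; split.
  move=> v; rewrite /exchangeA /exchangeB !(in_setI, in_setU, in_setD).
  by case: (cov v) => ->; rewrite ?orbT; case: (v \in below y); rewrite ?orbT; auto.
move=> a b; rewrite /exchangeA /exchangeB !(in_setI, in_setU, in_setD) !negb_or.
move=> aA aB bB /andP[bA by_]; move: bB; rewrite (negPf by_) /= orbF => bB.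
apply/negP => ab; have := sep a b; move: aA aB.
case: (boolP (a \in below y)) => ay /=.
  rewrite (edge_below ab ay by_) /= orbT => _ aB /(_ _ aB bB bA).
  by case: (cov a) => [->|aB']; [rewrite ab; move/(_ isT) | rewrite aB' in aB].
rewrite orbF andbT => aA aB /(_ aA _ bB bA); rewrite ab; move: aB.
by case: (a \in B) => // _ /(_ isT).
Qed.

(** The bag of [t] lies in [above y], so neither side loses any of its vertices and the bag is still
    split. *)
Lemma exchange_root A B y : y != t ->
  (A :&: bag t \subset exchangeA A y :&: bag t) /\
  (B :&: bag t \subset exchangeB B y :&: bag t).
Proof.
move=> yt; split; first by apply: setSI; apply: subsetUl.
apply/subsetP => x; rewrite /exchangeB !(in_setI, in_setU, in_setD) => /andP[-> xt].
by rewrite xt (subsetP (bag_root_above yt) x xt) /=; case: (x \in below y).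
Qed.


(** * Top nodes and adhesion sets *)

Lemma depth_ancestor z r : ancestor par z r -> d z <= d r.
Proof.
move/iter_findex <-; have [pt _ dP _] := rt.
elim: (findex _ _ _) => //= n; apply: leq_trans.
by set x := iter _ _ _; case: (eqVneq x t) => [->|/dP/ltnW //]; rewrite pt.
Qed.

(** Take [r] of least depth. Another node [z] holding [v] is no ancestor of [r], so [v] is both
    below and above [z] and hence also in the parent bag. *)
Lemma bag_top (v : G) : exists2 r, v \in bag r &
  forall z : tree D, v \in bag z -> z != r -> z != t /\ v \in bag (par z).
Proof.
have [z0 vz0] := bag_vertex D v.
have [r vr rmin] := @arg_minnP _ z0 (fun z => v \in bag z) d vz0.
exists r => // z vz zr; have nzr : ~~ ancestor par z r.
  apply/negP => anc; have [_ _ dP _] := rt.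
  have rt' : r != t.
    apply: contraTneq anc => rE; rewrite rE (not_ancestor_root rt) //.
    by rewrite -rE.
  have := depth_ancestor (ancestor_parW anc _); rewrite eq_sym => /(_ zr).
  by have := dP r rt'; have := rmin z vz; lia.
split; first by apply: contraNneq nzr => ->; apply: ancestor_root rt _.
have /(subsetP (below_above z)) : v \in below z :&: above z.
  by rewrite inE (subsetP (bag_below z)) //= (aboveI nzr vr).
by rewrite inE => /andP[].
Qed.

Lemma card_adhesion k z : adh D < k -> z != t -> #|bag z :&: bag (par z)| < k.
Proof.
move=> lt zt; apply: leq_ltn_trans lt; have [_ eP _ _] := rt.
exact: (leq_bigmax_cond (z, par z) (eP z zt)).
Qed.

(** * Leanness at the root *)

(* The number of common ancestors of the nodes whose bag contains [x], which
   measures the distance of [x] from the root. *)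
Definition weight (x : G) : nat := #|[set y | x \notin above y]|.

(** A node counted for [x] is an ancestor of [y], hence of all nodes holding [x']. The node [y]
    itself is counted for [x'] only. *)
Lemma weight_lt y x x' :
  x \in bag y -> x \in above y -> x' \notin above y -> weight x < weight x'.
Proof.
move=> xy xay x'y; apply: proper_card; apply/properP; split; last first.
  by exists y; rewrite [y \in _]in_set ?xay.
apply/subsetP => z; rewrite [z \in _]in_set [z \in _]in_set => xz.
have zy : ancestor par z y.
  by apply: contraR xz => zy; apply: aboveI zy xy.
apply: contra x'y; rewrite in_set => /existsP[w /andP[zw x'w]].
apply: aboveI x'w; apply: contra zw; exact: ancestor_trans.
Qed.

Definition splits_bag k A B :=
  [&& separation A B, k <= #|A :&: bag t| & k <= #|B :&: bag t|].

Definition optimal k A B : Prop :=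
  [/\ splits_bag k A B,
      forall A' B', splits_bag k A' B' -> #|A :&: B| <= #|A' :&: B'|
    & forall A' B', splits_bag k A' B' -> #|A' :&: B'| = #|A :&: B| ->
        \sum_(x in A :&: B) weight x <= \sum_(x in A' :&: B') weight x].

Lemma optimal_exists k A B : splits_bag k A B ->
  exists A' B', optimal k A' B' /\ #|A' :&: B'| <= #|A :&: B|.
Proof.
move=> AB.
pose P (X : {set G} * {set G}) := splits_bag k X.1 X.2.
pose o (X : {set G} * {set G}) := #|X.1 :&: X.2|.
have [X PX Xmin] := @arg_minnP _ (A, B) P o AB.
pose P' Y := P Y && (o Y == o X).
have P'X : P' X by rewrite /P' PX eqxx.
pose s (X : {set G} * {set G}) := \sum_(x in X.1 :&: X.2) weight x.
have [[A1 B1] /andP[PY /eqP oY] Ymin] := @arg_minnP _ X P' s P'X.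
exists A1, B1; split; last by move: (Xmin (A, B) AB); rewrite -oY.
split=> // [A' B' AB'|A' B' AB' E].
  by have := Xmin (A', B') AB'; rewrite -oY.
by apply: (Ymin (A', B')); apply/andP; split=> //; apply/eqP; rewrite -oY.
Qed.

Lemma splits_bag_sym k A B : splits_bag k A B = splits_bag k B A.
Proof. by rewrite /splits_bag separation_sym; congr (_ && _); rewrite andbC. Qed.

Lemma optimal_sym k A B : optimal k A B -> optimal k B A.
Proof.
case=> AB min1 min2; split; first by rewrite splits_bag_sym.
  by move=> A' B'; rewrite splits_bag_sym (setIC B) (setIC A'); apply: min1.
by move=> A' B'; rewrite splits_bag_sym (setIC B) (setIC A'); apply: min2.
Qed.

(** The inequality is minimality of the order. In case of equality the weights decide: adhesion
    vertices are lighter than separator vertices strictly below [y], so the exchange would lower the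
    weight unless the adhesion part already lies in the separator. *)
Lemma optimal_exchange k A B y : optimal k A B -> y != t ->
  #|A :&: B :&: below y| <= #|below y :&: above y :&: B| /\
  (#|A :&: B :&: below y| = #|below y :&: above y :&: B| ->
   below y :&: above y :&: B \subset A).
Proof.
case=> AB min1 min2 yt.
have AB' : splits_bag k (exchangeA A y) (exchangeB B y).
  case/and3P: AB => sepAB kA kB; have [sA sB] := exchange_root A B yt.
  rewrite /splits_bag exchange_separation //=.
  by rewrite (leq_trans kA) ?(leq_trans kB) ?subset_leq_card.
have dis : [disjoint A :&: B :\: below y & below y :&: above y :&: B].
  rewrite -setI_eq0; apply/eqP/setP => x; rewrite !(in_setI, in_setD, in_set0).
  by case: (x \in below y); rewrite ?andbF.
have := min1 _ _ AB'; have := min2 _ _ AB'; rewrite exchangeI.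
rewrite (cardsU _ (_ :&: B)) (disjoint_setI0 dis) cards0 subn0.
rewrite -(cardsID (below y) (A :&: B)).
rewrite [X in _ -> _ <= X](eq_bigl
  [predU A :&: B :\: below y & below y :&: above y :&: B]);
  last by move=> x; rewrite in_setU.
rewrite bigU // [X in _ -> X <= _](big_setID (below y)) /=.
set X := A :&: B :&: below y; set Y := below y :&: above y :&: B => h2 h1.
have le : #|X| <= #|Y| by lia.
split=> // eXY; suff /subset_trans : Y \subset X.
  by apply; apply/subsetP => x; rewrite !inE => /andP[/andP[]].
apply: (@subset_of_sum_leq _ weight _ _ eXY) => [a b|]; last by move: h2; lia.
rewrite !(in_setD, in_setI) => /andP[_ /andP[/andP[ay ay'] _]].
case/andP=> nbY /andP[/andP[bA bB] by_]; move: nbY; rewrite by_ bB andbT /= => nby.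
apply: weight_lt nby; last by [].
by have := subsetP (below_above y) a; rewrite !in_setI ay ay' => /(_ isT)/andP[].
Qed.

(** * The bags of the two copies *)

(** A separator vertex is put in every bag from its nodes up to the root, where the copies are
    joined. *)
Definition copy_bag (A B : {set G}) z := (bag z :\: B) :|: (A :&: B :&: below z).

Lemma card_copy_bag A B z :
  #|copy_bag A B z| = #|bag z :\: B| + #|A :&: B :&: below z|.
Proof.
rewrite /copy_bag cardsU; set X := _ :&: (_ :&: below z).
have -> : X = set0; last by rewrite cards0 subn0.
by apply/setP => x; rewrite !(in_setI, in_setD, in_set0); case: (x \in B); rewrite ?andbF.
Qed.

Lemma mem_copy_bag (A B : {set G}) (z : tree D) x :
  x \in A -> x \in bag z -> x \in copy_bag A B z.
Proof.
move=> xA xz; rewrite !(in_setU, in_setI, in_setD) xA xz (subsetP (bag_below z)) //.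
by case: (x \in B).
Qed.

(** The copy loses [bag z :&: B], which contains the adhesion part in [B], and by [optimal_exchange]
    gains no more than the size of that part. Equality makes both parts coincide and lie in [A]. *)
Lemma card_copy_bag_le k A B z : optimal k A B -> z != t ->
  #|copy_bag A B z| <= #|bag z| /\
  (#|copy_bag A B z| = #|bag z| -> bag z \subset A).
Proof.
move=> opt zt; have [le subA] := optimal_exchange opt zt.
have [/and3P[/separationP[cov _] _ _] _ _] := opt.
have sE : below z :&: above z :&: B \subset bag z :&: B.
  by apply: setSI; apply: subset_trans (below_above z) (subsetIl _ _).
have lE := subset_leq_card sE.
rewrite card_copy_bag -(cardsID B (bag z)); split; first by lia.
move=> E; have eE : below z :&: above z :&: B = bag z :&: B.
  by apply/eqP; rewrite eqEcard sE; lia.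
rewrite eE in subA le lE.
have {}subA : bag z :&: B \subset A by apply: subA; lia.
apply/subsetP => x xz; case: (cov x) => // xB.
by apply: (subsetP subA); rewrite inE xz.
Qed.

(** The same count with the adhesion set [E] in place of the bag. *)
Lemma card_copy_adhesion k A B z : optimal k A B -> adh D < k -> z != t ->
  #|copy_bag A B z :&: copy_bag A B (par z)| < k.
Proof.
move=> opt adhk zt; have [le _] := optimal_exchange opt zt.
apply: leq_ltn_trans (card_adhesion adhk zt).
set E := bag z :&: bag (par z).
rewrite -(cardsID B E) addnC.
apply: (@leq_trans #|(E :\: B) :|: (A :&: B :&: below z)|).
  apply: subset_leq_card; apply/subsetP => x.
  rewrite !(in_setU, in_setI, in_setD).
  by case: (x \in B); case: (x \in A); case: (x \in bag z); case: (x \in bag (par z));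
    case: (x \in below z); rewrite ?andbF.
apply: leq_trans (leq_card_setU _ _) _; rewrite leq_add2l.
apply: leq_trans le _; apply: subset_leq_card; apply: setSI; exact: below_above.
Qed.

Lemma atomic_lean k A B : 0 < k -> atomic k D -> separation A B ->
  #|A :&: B| < k -> #|A :&: bag t| < k \/ #|B :&: bag t| < k.
Proof.
move=> k0 atD sepAB lt; apply/orP; rewrite !ltnNge -negb_and; apply/negP => /andP[kA kB].
have /optimal_exists[A' [B' [opt le]]] : splits_bag k A B by rewrite /splits_bag sepAB kA.
have {A B sepAB kA kB le} {}lt := leq_ltn_trans le lt.
move: A' B' opt lt => A B opt lt.
have opt' := optimal_sym opt.
have [/and3P[sepAB kA kB] _ _] := opt.
have /separationP[cov _] := sepAB.
have [adhk _] := atD.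
pose F a := match a with inl z => copy_bag A B z | inr z => copy_bag B A z end.
have ltBA : #|B :&: A| < k by rewrite setIC.
apply: (@double_not_atomic k k F t k0) atD.
- move=> v; have [z vz] := bag_vertex D v.
  by case: (cov v) => vX; [exists (inl z) | exists (inr z)]; apply: mem_copy_bag.
- move=> v w vw; have [z [vz wz]] := bag_edge D vw.
  by case: (separation_edge sepAB vw) => -[vX wX]; [exists (inl z) | exists (inr z)];
    split; apply: mem_copy_bag.
(* A separator vertex has its top at [inl t]; any other vertex lives in a single copy and keeps its
   old top node there. *)
- move=> v; case: (boolP ((v \in A) && (v \in B))) => [/andP[vA vB]|nAB].
    exists (inl t) => [|a va at_].
      by rewrite /F !(in_setU, in_setI) below_root in_setT vA vB orbT.
    have vb z : v \in below z -> (v \in F (inl z)) && (v \in F (inr z)).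
      by move=> vz; rewrite /F !(in_setU, in_setI) vA vB vz !orbT.
    have bv z : v \in F (inl z) \/ v \in F (inr z) -> v \in below z.
      by rewrite /F !(in_setU, in_setI, in_setD) vA vB /= => -[].
    split=> //; case: a va at_ => z vz zt /=.
      have vz' : v \in below z by apply: bv; left.
      by have /andP[] := vb (par z) (subsetP (below_par z) v vz').
    have vz' : v \in below z by apply: bv; right.
    have /andP[H1 H2] := vb (par z) (subsetP (below_par z) v vz').
    case: eqP => // zt'; have [pt _ _ _] := rt.
    by rewrite zt' pt in H1.
  have [r vr rP] := bag_top v.
  case: (cov v) => vX; move: nAB; rewrite vX ?andbT /= => nv.
    have FE a : v \in F a = if a is inl z then v \in bag z else false.
      by case: a => z; rewrite /F !(in_setU, in_setI, in_setD) vX (negPf nv) ?andbF ?orbF.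
    exists (inl r) => [|a]; rewrite FE //; case: a => // z vz zr.
    have [zt vp] := rP z vz zr.
    by split; rewrite ?FE //; apply: contraNneq zt => -[->].
  have FE a : v \in F a = if a is inr z then v \in bag z else false.
    by case: a => z; rewrite /F !(in_setU, in_setI, in_setD) vX (negPf nv) ?andbF ?orbF.
  exists (inr r) => [|a]; rewrite FE //; case: a => // z vz zr.
  have [zt vp] := rP z vz zr.
  by split=> //; rewrite /= (negPf zt) FE.
- case=> z zt /=.
    by apply: card_copy_adhesion opt adhk _; apply: contraNneq zt => ->.
  case: eqVneq => [->|zt']; last exact: card_copy_adhesion opt' adhk zt'.
  (* The two root bags share only separator vertices. *)
  apply: leq_ltn_trans lt; apply: subset_leq_card; apply/subsetP => x.
  rewrite !(in_setI, in_setU, in_setD).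
  by have := cov x; case: (x \in A); case: (x \in B); rewrite ?andbF // => -[].
- move=> z; case: (eqVneq z t) => [->|zt].
    (* Each root bag trades at least [k] vertices for the fewer than [k] of the separator. *)
    constructor 1; rewrite !card_copy_bag below_root !setIT.
    have := cardsID A (bag t); have := cardsID B (bag t).
    by rewrite !(setIC (bag t)); lia.
  have [leA eA] := card_copy_bag_le opt zt; have [leB eB] := card_copy_bag_le opt' zt.
  case: (ltnP #|copy_bag A B z| #|bag z|) => [ltA|geA]; last first.
    constructor 2; split=> //.
    (* As [bag z] lies in [A], the other copy holds separator vertices only. *)
    have zA : bag z \subset A by apply: eA; lia.
    rewrite /F card_copy_bag; move: zA; rewrite -setD_eq0 => /eqP ->.
    by rewrite cards0; apply: leq_ltn_trans ltBA; apply/subset_leq_card/subsetIl.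
  case: (ltnP #|copy_bag B A z| #|bag z|) => [ltB|geB]; first by constructor 1.
  constructor 3; split=> //.
  have zB : bag z \subset B by apply: eB; lia.
  rewrite /F card_copy_bag; move: zB; rewrite -setD_eq0 => /eqP ->.
  by rewrite cards0; apply: leq_ltn_trans lt; apply/subset_leq_card/subsetIl.
- by apply: leq_trans kA _; apply/subset_leq_card/subsetIr.
- rewrite /F card_copy_bag below_root setIT; have := cardsID B (bag t).
  by rewrite (setIC (bag t)); lia.
- rewrite /F card_copy_bag below_root setIT; have := cardsID A (bag t).
  by rewrite (setIC (bag t)); lia.
Qed.

(** * Separators meet the crossed branches *)

(* Otherwise the branch at [y] falls apart along the separation, and each part
   can be attached to [t] separately. *)
Lemma branch_meets_separator k A B y u w : 0 < k -> atomic k D ->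
  separation A B -> y != t -> par y = t ->
  u \in bag y -> u \in A -> u \notin B -> w \in bag y -> w \in B -> w \notin A ->
  exists2 x, x \in A :&: B & x \in below y :\: bag t.
Proof.
move=> k0 atD sepAB yt py uy uA uB wy wB wA.
case: (boolP [exists x in A :&: B, x \in below y :\: bag t]) => [/exists_inP//|].
move/exists_inPn => noX; exfalso.
have inS x : x \in A -> x \in B -> x \in below y -> x \in bag t.
  move=> xA xB xy; have xS : x \in A :&: B by rewrite in_setI xA.
  by have := noX x xS; rewrite in_setD xy andbT negbK.
have [adhk _] := atD; have [pt _ _ _] := rt.
have nyt := not_ancestor_root rt yt.
have /separationP[cov _] := sepAB.
have crossP v : v \in below y -> v \in above y -> (v \in bag y) && (v \in bag t).
  move=> v1 v2; rewrite -py -in_setI; apply: (subsetP (below_above y)).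
  by rewrite in_setI v1.
(* Only the branch at [y] is split. In the second copy the other bags are empty, except that the
   root receives the part of the adhesion set in [B]. *)
pose F a := match a with
  | inl z => if ancestor par y z then bag z :&: A else bag z
  | inr z => if ancestor par y z then bag z :&: B
             else if z == t then bag y :&: bag t :&: B else set0 end.
have Fl z v : v \in bag z -> v \in A -> v \in F (inl z).
  by move=> vz vA; rewrite /F; case: ifP; rewrite ?in_setI ?vz.
have Fr z v : ancestor par y z -> v \in bag z -> v \in B -> v \in F (inr z).
  by move=> yz vz vB; rewrite /F yz in_setI vz.
have Fn z v : ~~ ancestor par y z -> v \in bag z -> v \in F (inl z).
  by move=> yz vz; rewrite /F (negPf yz).
have Fsub z : (F (inl z) \subset bag z) && (F (inr z) \subset bag z).
  rewrite /F; case: ifP => _; first by rewrite !subsetIl.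
  rewrite subxx; case: eqP => [->|_]; last exact: sub0set.
  by rewrite -setIA setIC -setIA subsetIl.
have FrB z v : v \in F (inr z) -> v \in B.
  by rewrite /F; do 2?[case: ifP => _]; rewrite ?in_setI ?in_set0 => // /andP[].
have FlA z v : ancestor par y z -> v \in F (inl z) -> v \in A.
  by move=> yz; rewrite /F yz in_setI => /andP[].
apply: (@double_not_atomic k #|bag y| F y k0) atD.
- move=> v; have [z vz] := bag_vertex D v.
  case: (boolP (ancestor par y z)) => yz; last by exists (inl z); apply: Fn.
  by case: (cov v) => vX; [exists (inl z); apply: Fl | exists (inr z); apply: Fr].
- move=> v v' vv'; have [z [vz v'z]] := bag_edge D vv'.
  case: (boolP (ancestor par y z)) => yz; last by exists (inl z); split; apply: Fn.
  by case: (separation_edge sepAB vv') => -[vX v'X]; [exists (inl z) | exists (inr z)];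
    split; by [apply: Fl | apply: Fr].
- move=> v; have [r vr rP] := bag_top v.
  have memF a : v \in F a -> v \in bag (match a with inl z => z | inr z => z end).
    by case: a => z; have /andP[s1 s2] := Fsub z;
      [apply: (subsetP s1) | apply: (subsetP s2)].
  case: (boolP (ancestor par y r)) => yr; last first.
    exists (inl r); first exact: Fn.
    case=> z vF zr; have vz := memF _ vF.
      have [zt vp] := rP z vz zr; split; first by apply: contraNneq zt => -[->].
      rewrite [double_par _]/=.
      case: (boolP (ancestor par y (par z))) => yz; last exact: Fn.
      by apply: Fl => //; apply: FlA vF; apply: ancestor_par.
    split=> //=; case: eqVneq => [zt|zt]; first by rewrite zt in vz; apply: Fn.
    case: (boolP (ancestor par y z)) vF => yz;
      rewrite /F ?(negPf yz) ?(negPf zt) ?in_set0 //.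
    rewrite yz in_setI => /andP[_ vB].
    have zr' : z != r by apply: contraNneq yr => <-.
    have [_ vp] := rP z vz zr'.
    case: (eqVneq z y) vp => [->|zy] vp.
      have vy : v \in bag y.
        have := crossP v (belowI yz vz) (aboveI yr vr); by case/andP.
      by rewrite py (negPf nyt) eqxx !in_setI vy vB andbT -py; move: vp; rewrite py => ->.
    by rewrite (ancestor_parW yz zy) in_setI vp.
  (* A vertex with its top in the branch misses [bag t]; hence all its nodes are in the branch and,
     by [inS], it lies on one side only. *)
  have vt : v \notin bag t.
    apply/negP => vt; case: (eqVneq t r) => [tr|tr]; first by rewrite tr yr in nyt.
    by have [] := rP t vt tr; rewrite eqxx.
  have yT z : v \in bag z -> ancestor par y z.
    move=> vz; apply: contraR vt => yz.
    by have /andP[] := crossP v (belowI yr vr) (aboveI yz vz).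
  case: (boolP (v \in A)) => vA.
    have vB : v \notin B by apply: contra vt => vB; apply: inS (belowI yr vr).
    exists (inl r); first exact: Fl.
    case=> z vF zr; have vz := memF _ vF; last by rewrite (FrB _ _ vF) in vB.
    have [zt vp] := rP z vz zr; split; first by apply: contraNneq zt => -[->].
    exact: Fl.
  have vB : v \in B by case: (cov v) => // vA'; rewrite vA' in vA.
  exists (inr r); first exact: Fr.
  case=> z vF zr; have vz := memF _ vF; first by rewrite (FlA z v (yT z vz) vF) in vA.
  have [zt vp] := rP z vz zr; split=> //=; rewrite (negPf zt).
  by apply: Fr => //; apply: yT.
- have sub a b : F a :&: F b \subset bag (match a with inl z => z | inr z => z end)
        :&: bag (match b with inl z => z | inr z => z end).
    by apply: setISS; [case: a | case: b] => z; have /andP[] := Fsub z.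
  case=> z zt.
    by apply: leq_ltn_trans (subset_leq_card (sub _ _)) _; apply: card_adhesion.
  rewrite [double_par _]/=; case: eqVneq => [->|zt'].
    apply: leq_ltn_trans (card_adhesion adhk yt); apply: subset_leq_card.
    by rewrite /F (negPf nyt) eqxx py -setIA -setIA; apply: setIS; apply: subsetIl.
  by apply: leq_ltn_trans (subset_leq_card (sub _ _)) _; apply: card_adhesion.
- move=> z; case: (boolP (ancestor par y z)) => yz; last first.
    (* The second copy is empty here, or at [t] a part of [bag y] missing [u]. *)
    constructor 2; rewrite /F (negPf yz); split=> //.
    case: eqP => _; last by rewrite cards0; apply/card_gt0P; exists u.
    apply: (proper_subset_card (x := u)); rewrite // ?in_setI ?(negPf uB) ?andbF //.
    by rewrite -setIA subsetIl.
  (* Separator vertices below [y] lie in [bag t], hence in [bag y]; missing [x], they cannot fill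
     it. *)
  have zsub x X : bag z :&: X \subset A :&: B -> x \in bag y -> x \notin X ->
      #|bag z :&: X| < #|bag y|.
    move=> sX xy xX; apply: (proper_subset_card (x := x)) => //.
      apply/subsetP => v vzX; have := subsetP sX v vzX; rewrite in_setI => /andP[vA vB].
      have vb : v \in below y.
        by move: vzX; rewrite in_setI => /andP[vz _]; apply: belowI vz.
      have va := subsetP (bag_root_above yt) v (inS v vA vB vb).
      by have /andP[] := crossP v vb va.
    by rewrite in_setI (negPf xX) andbF.
  rewrite /F yz; case: (boolP (bag z \subset A)) => zA.
    constructor 2; split; first exact/subset_leq_card/subsetIl.
    apply: zsub uy uB; exact: setSI.
  case: (boolP (bag z \subset B)) => zB.
    constructor 3; split; last exact/subset_leq_card/subsetIl.
    by apply: zsub wy wA; rewrite setIC; apply: setIS.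
  case/subsetPn: zA => a az aA; case/subsetPn: zB => b bz bB.
  constructor 1; split;
    [apply: (proper_subset_card (x := a)) | apply: (proper_subset_card (x := b))];
    by rewrite ?subsetIl // in_setI ?(negPf aA) ?(negPf bB) andbF.
- by [].
- apply: (proper_subset_card (x := w)) => //; rewrite /F ancestor_refl ?subsetIl //.
  by rewrite in_setI (negPf wA) andbF.
- apply: (proper_subset_card (x := u)) => //; rewrite /F ancestor_refl ?subsetIl //.
  by rewrite in_setI (negPf uB) andbF.
Qed.

(** * The bound on the torso degree *)

(** The first term counts neighbours in [A]. For the others, each of the at most [k - 1] separator
    vertices pays for one branch, whose adhesion set has at most [k - 2] vertices besides [u]. *)
Lemma torso_degree_le k A B u : 0 < k -> atomic k D -> separation A B ->
  #|A :&: B| < k -> #|A :&: bag t| < k -> u \in bag t -> u \in A -> u \notin B ->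
  degree (torso t) u <= (k - 2) + (k - 1) * (k - 2).
Proof.
move=> k0 atD sepAB ltS ltA ut uA uB; have [adhk _] := atD.
have /separationP[cov sep] := sepAB.
pose C x := if [pick y | [&& y != t, par y == t, x \in below y & u \in bag y]] is Some y
            then (bag y :&: bag t) :\ u else set0.
have card_rem (X : {set G}) : u \in X -> #|X| < k -> #|X :\ u| <= k - 2.
  by move=> uX; rewrite (cardsD1 u X) uX; lia.
have CE x : #|C x| <= k - 2.
  rewrite /C; case: pickP => [y /and4P[yt /eqP py _ uy]|_]; last by rewrite cards0.
  apply: card_rem; first by rewrite in_setI uy.
  by rewrite -{1}py; apply: card_adhesion.
have sub : [set w | torso t u w] \subset
    ((A :&: bag t) :\ u) :|: \bigcup_(x in A :&: B) C x.
  apply/subsetP => w; rewrite inE => /and4P[_ wt uw adj].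
  rewrite in_setU in_setD1 in_setI eq_sym uw wt /=.
  case: (boolP (w \in A)) => //= wA.
  have wB : w \in B by case: (cov w) => // wA'; rewrite wA' in wA.
  move: adj; rewrite (negPf (sep u w uA uB wB wA)) /= => /existsP[y /and3P[ty uy wy]].
  have [yt py] : y != t /\ par y = t.
    by have [_ _ _ eP] := rt; case: (eP t y ty) => -[] //; rewrite eqxx.
  have [x xS] := branch_meets_separator k0 atD sepAB yt py uy uA uB wy wB wA.
  rewrite in_setD => /andP[xt xy].
  apply/bigcupP; exists x => //; rewrite /C; case: pickP => [y'|none]; last first.
    by have := none y; rewrite yt py eqxx xy uy.
  case/and4P=> y't /eqP py' xy' uy'; suff -> : y' = y.
    by rewrite in_setD1 eq_sym uw in_setI wy wt.
  move: (xy); rewrite in_set => /existsP[z /andP[yz xz]].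
  apply: (ancestor_children rt y't yt py' py _ yz).
  (* If [z] were outside the branch of [y'], then [x] would be in its adhesion set and so in
     [bag t]. *)
  apply: contraR xt => y'z; rewrite -py'.
  have /(subsetP (below_above y')) : x \in below y' :&: above y'.
    by rewrite in_setI xy' (aboveI y'z xz).
  by rewrite in_setI => /andP[].
rewrite /degree; apply: leq_trans (subset_leq_card sub) _.
apply: leq_trans (leq_card_setU _ _) _; apply: leq_add.
  by apply: card_rem; rewrite // in_setI uA.
apply: (@leq_trans (\sum_(x in A :&: B) (k - 2))); last first.
  by rewrite sum_nat_const leq_mul2r; apply/orP; right; lia.
elim/big_rec2: _ => [|x n X _ IH]; first by rewrite cards0.
by apply: leq_trans (leq_card_setU _ _) _; apply: leq_add.
Qed.

End RootedDecomposition.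

(** * Menger's theorem *)

Section Menger.
Variable V : finType.
Implicit Types (e : rel V) (A B S : {set V}).

Definition walk e A B (p : seq V) : bool :=
  if p is a :: s then [&& a \in A, path e a s & last a s \in B] else false.

Definition separates e A B S : Prop := forall p, walk e A B p -> has (mem S) p.

Definition linked e A B (k : nat) : Prop :=
  exists f : 'I_k -> seq V,
    [/\ forall i, walk e A B (f i), forall i, uniq (f i)
      & forall i j x, x \in f i -> x \in f j -> i = j].

(** The boolean form makes the existence of a small separator decidable. *)
Lemma separatesP e A B S :
  reflect (separates e A B S)
    [forall a in A :\: S, forall b in B, ~~ connect (induced e (~: S)) a b].
Proof.
apply: (iffP forall_inP) => [sep [|a s] //= /and3P[aA pth lB]|sep a].
  apply/negPn/negP; rewrite negb_or => /andP[aS /hasPn sS].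
  have aAS : a \in A :\: S by rewrite inE aS.
  have /forall_inP/(_ _ lB)/negP := sep a aAS; apply.
  apply/connectP; exists s => //.
  elim: s a aS pth sS {aA lB aAS} => //= b s IHs a aS /andP[ab bs] sS.
  have bS : b \notin S by apply: sS; rewrite mem_head.
  rewrite /induced /= !inE aS bS ab /=; apply: IHs => // c cs.
  by apply: sS; rewrite inE cs orbT.
rewrite inE => /andP[aS aA]; apply/forall_inP => b bB; apply/negP => /connectP[s pth bE].
have := sep (a :: s); rewrite /walk aA -bE bB andbT /= => /(_ _).
have pe : path e a s by apply: sub_path pth => x y /and3P[].
move=> /(_ pe); rewrite (negPf aS) /= => /hasP[x xs /= xS].
elim: s a pth xs {aS aA bE pe} => //= c s IHs a /andP[/and3P[_ cS _] cs].
rewrite inE => /orP[/eqP xc|]; last exact: IHs cs.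
by move: cS; rewrite inE -xc xS.
Qed.

Lemma walk_subrel e e' A B p : subrel e e' -> walk e A B p -> walk e' A B p.
Proof.
by move=> ee'; case: p => //= a s /and3P[-> /(sub_path ee') -> ->].
Qed.

Lemma linked_subrel e e' A B k : subrel e e' -> linked e A B k -> linked e' A B k.
Proof.
by move=> ee' [f [fw fu fd]]; exists f; split=> // i; apply: walk_subrel (fw i).
Qed.

Definition del e (x y : V) : rel V := [rel a b | e a b && ((a, b) != (x, y))].

Lemma del_subrel e x y : subrel (del e x y) e.
Proof. by move=> a b /andP[]. Qed.

(* Stopped at its first vertex in [P], the walk never leaves [x]. *)
Lemma walk_prefix e A B (P : {set V}) p x y : x \in P ->
  walk e A B p -> has (mem P) p ->
  exists2 q, walk (del e x y) A P q & {subset q <= p}.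
Proof.
move=> xP; case: p => // a s /= /and3P[aA pth _] hP.
suff [q [qp ql qs]] : exists q, [/\ path (del e x y) a q, last a q \in P
    & {subset a :: q <= a :: s}].
  by exists (a :: q) => //=; rewrite aA qp.
elim: s a pth hP {aA} => [|b s IHs] a /=.
  by rewrite orbF => _ aP; exists [::]; split.
case/andP=> ab bs; case: (boolP (a \in P)) => aP.
  by move=> _; exists [::]; split=> // c; rewrite !inE => ->.
move=> hP; have [q [qp ql qs]] := IHs b bs hP.
exists (b :: q); split=> //=.
  have nx : a != x by apply: contraNneq aP => ->.
  by rewrite /del /= qp ab xpair_eqE negb_and nx.
move=> c; rewrite inE => /orP[/eqP ->|/qs cs]; first exact: mem_head.
by rewrite inE cs orbT.
Qed.

(* Started at its last vertex in [P], the walk never enters [y]. *)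
Lemma walk_suffix e A B (P : {set V}) p x y : y \in P ->
  walk e A B p -> has (mem P) p ->
  exists2 q, walk (del e x y) P B q & {subset q <= p}.
Proof.
move=> yP; elim: p A => // a s IHs A /= /and3P[aA pth lB] hP.
case: (boolP (has (mem P) s)) => hs.
  case: s pth lB hs IHs {hP} => // b s /= /andP[ab bs] lB hs IHs.
  have [|q qw qs] := IHs [set b] _ hs; first by rewrite inE eqxx bs.
  by exists q => // c /qs cs; rewrite inE cs orbT.
move: hP; rewrite (negPf hs) orbF => aP.
exists (a :: s) => //=; rewrite aP lB andbT /=.
elim: s a pth hs {IHs aA lB aP} => //= b s IHs a /andP[ab bs].
rewrite negb_or => /andP[bP sP]; rewrite IHs // andbT /del /= ab.
have ny : b != y by apply: contraNneq bP => ->.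
by rewrite xpair_eqE negb_and ny orbT.
Qed.

(** A walk missing [x] or [y] survives the deletion of the arc, and so meets [S]. *)
Lemma walk_uses_edge e A B S p x y :
  separates (del e x y) A B S -> walk e A B p -> ~~ has (mem S) p ->
  (x \in p) && (y \in p).
Proof.
move=> sep pw; apply: contraR => nxy; apply: sep.
case: p pw nxy => //= a s /and3P[-> pth ->] nxy; rewrite andbT.
elim: s a pth nxy => //= b s IHs a /andP[ab bs] nxy.
rewrite /del /= ab IHs //.
  rewrite andbT; apply: contra nxy => /eqP[-> ->].
  by rewrite !inE !eqxx orbT.
by apply: contra nxy => /andP[xs ys]; rewrite !(in_cons a) xs ys !orbT.
Qed.

(* As [P] has exactly [k] elements, each of them lies on one of the [k] lists. *)
Lemma reindex_by_mark (P : {set V}) k (f : 'I_k -> seq V) (g : 'I_k -> V) :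
  #|P| = k -> (forall i, g i \in P) -> (forall i, g i \in f i) ->
  (forall i j x, x \in f i -> x \in f j -> i = j) ->
  exists F : V -> seq V,
    (forall p, p \in P -> exists2 i, F p = f i & g i = p) /\
    (forall p q x, p \in P -> q \in P -> x \in F p -> x \in F q -> p = q).
Proof.
move=> cP gP gf fd.
have ginj : injective g by move=> i j gij; apply: fd (gf i) _; rewrite gij.
have gim : [set g i | i in 'I_k] = P.
  apply/eqP; rewrite eqEcard card_imset // card_ord cP leqnn andbT.
  by apply/subsetP => _ /imsetP[i _ ->].
have /fin_all_exists[F FP] p : exists s : seq V,
    p \in P -> exists2 i, s = f i & g i = p.
  case: (boolP (p \in P)) => pP; last by exists [::].
  by move: (pP); rewrite -gim => /imsetP[i _ ->]; exists (f i) => _; exists i.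
exists F; split=> // p q x /FP[i -> <-] /FP[j -> <-] xi xj.
by rewrite (fd i j x).
Qed.

(** Labelling the walks by their ends in [P] allows matching each with its continuation. *)
Lemma linked_end e A (P : {set V}) k : linked e A P k -> #|P| = k ->
  exists F : V -> seq V,
    [/\ forall p, p \in P -> walk e A [set p] (F p),
        forall p, p \in P -> uniq (F p)
      & forall p q x, p \in P -> q \in P -> x \in F p -> x \in F q -> p = q].
Proof.
case=> f [fw fu fd] cP.
have /fin_all_exists[g gP] i : exists b,
    [/\ b \in P, b \in f i & walk e A [set b] (f i)].
  move: (fw i); case: (f i) => //= a s /and3P[-> -> lP].
  by exists (last a s); rewrite lP mem_last inE eqxx.
have [||F [FP Fd]] := reindex_by_mark (g := g) cP _ _ fd.
- by move=> i; have [] := gP i.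
- by move=> i; have [] := gP i.
exists F; split=> // p /FP[i -> //].
by move=> <-; have [] := gP i.
Qed.

Lemma linked_begin e (P : {set V}) B k : linked e P B k -> #|P| = k ->
  exists F : V -> seq V,
    [/\ forall p, p \in P -> walk e [set p] B (F p),
        forall p, p \in P -> uniq (F p)
      & forall p q x, p \in P -> q \in P -> x \in F p -> x \in F q -> p = q].
Proof.
case=> f [fw fu fd] cP.
have /fin_all_exists[g gP] i : exists b,
    [/\ b \in P, b \in f i & walk e [set b] B (f i)].
  move: (fw i); case: (f i) => //= a s /and3P[aP -> ->].
  by exists a; rewrite aP mem_head inE eqxx.
have [||F [FP Fd]] := reindex_by_mark (g := g) cP _ _ fd.
- by move=> i; have [] := gP i.
- by move=> i; have [] := gP i.
exists F; split=> // p /FP[i -> //].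
by move=> <-; have [] := gP i.
Qed.

(* The glued walks are simple and disjoint, because a common vertex of a walk to
   [x |: S] and a walk from [y |: S] yields a walk from [A] to [B], which must
   meet [S]. *)
Lemma glue_walks e A B S x y k :
  e x y -> separates (del e x y) A B S -> #|S| < k ->
  #|x |: S| = k -> #|y |: S| = k ->
  linked (del e x y) A (x |: S) k -> linked (del e x y) (y |: S) B k ->
  linked e A B k.
Proof.
move=> exy sepS ltS cP cQ /linked_end/(_ cP)[F [Fw Fu Fd]].
move=> /linked_begin/(_ cQ)[H [Hw Hu Hd]].
have xS : x \notin S by move: ltS; rewrite -cP cardsU1; case: (x \in S) => //=; lia.
have yS : y \notin S by move: ltS; rewrite -cQ cardsU1; case: (y \in S) => //=; lia.
have SP z : z \in S -> z \in x |: S by move=> zS; rewrite inE zS orbT.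
have SQ z : z \in S -> z \in y |: S by move=> zS; rewrite inE zS orbT.
have Fend p : p \in x |: S -> p \in F p.
  move/Fw; case: (F p) => //= a s /and3P[_ _].
  by rewrite inE => /eqP {1}<-; apply: mem_last.
have Hhead q : q \in y |: S -> q \in H q.
  by move/Hw; case: (H q) => //= a s /and3P[]; rewrite inE => /eqP ->; rewrite mem_head.
have meet p q w : p \in x |: S -> q \in y |: S -> w \in F p -> w \in H q ->
    [/\ p = q, w = p & p \in S].
  move=> pP qQ wF wH.
  suff [wp pS] : w = p /\ p \in S.
    by split=> //; apply: (Hd p q w) => //; [exact: SQ | rewrite wp; apply/Hhead/SQ].
  move: (Fw p pP) (Hw q qQ) (Fu p pP) (Hu q qQ) (wF) (wH).
  case EF : (F p) => [//|a s]; case EH : (H q) => [//|b r] /=.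
  rewrite !in_set1 => /and3P[aA pas /eqP ls] /and3P[/eqP bq pbr lr] us ur ws wr.
  case/splitPl: ws EF pas ls us => s1 s2 l1 EF pas ls us.
  case/splitPl: wr EH pbr lr ur => r1 r2 l2 EH pbr lr ur.
  (* Following [F p] up to [w] and [H q] from there is a walk from [A] to [B]. It meets [S] either
     at the end of [F p], which forces [w = p], or at the start of [H q], which does not recur after
     [w]. *)
  have : has (mem S) (a :: s1 ++ r2).
    apply: sepS => /=; rewrite aA last_cat l1; move: pas pbr lr.
    by rewrite !cat_path last_cat l1 l2 => /andP[-> _] /andP[_ ->] ->.
  case/hasP=> z; rewrite -cat_cons mem_cat => /orP[zs|zr] /= zS.
    have zp : z = p.
      apply: (Fd z p z) => //; [exact: SP | exact/Fend/SP |].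
      by rewrite EF -cat_cons mem_cat zs.
    rewrite -zp; split=> //; rewrite zp.
    case: s2 ls us {EF pas} => [|c s2]; first by rewrite cats0 l1.
    rewrite last_cat => ls; rewrite -/(uniq (a :: s1 ++ _)) -cat_cons cat_uniq.
    case/and3P=> _ /hasPn/(_ p) + _.
    by rewrite -{1}ls /= mem_last => /(_ isT)/negP[]; rewrite -zp.
  have zq : z = q.
    apply: (Hd z q z) => //; [exact: SQ | exact/Hhead/SQ |].
    by rewrite EH inE mem_cat zr !orbT.
  by move: ur; rewrite bq -zq mem_cat zr orbT.
(* From [x] the walk takes the deleted arc to [y]; elsewhere the head of [H p] is dropped, being
   already the end of [F p]. *)
pose tl p := if p == x then H y else behead (H p).
pose L p := F p ++ tl p.
have tlH p w : p \in x |: S -> w \in tl p ->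
    exists q, [/\ q \in y |: S, w \in H q & q = if p == x then y else p].
  rewrite !inE /tl; case: eqP => [_ _ wH|_ /= pS wH].
    by exists y; rewrite !inE eqxx.
  by exists p; split; rewrite ?SQ // mem_behead.
have Lw p : p \in x |: S -> walk e A B (L p).
  move=> pP; have := Fw p pP; rewrite /L /tl; case: (F p) => //= a s /and3P[-> pas].
  rewrite in_set1 => /eqP ls; rewrite cat_path last_cat ls.
  rewrite (sub_path (@del_subrel _ x y) pas) /=.
  case: eqP pP => [-> _|/eqP px]; last rewrite in_setU1 (negPf px) /= => /SQ pQ.
    have := Hw y (setU11 _ _); case: (H y) => //= b r /and3P[].
    by rewrite in_set1 => /eqP -> pbr ->; rewrite exy (sub_path (@del_subrel _ x y) pbr).
  have := Hw p pQ; case: (H p) => //= b r /and3P[].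
  by rewrite in_set1 => /eqP -> pbr ->; rewrite (sub_path (@del_subrel _ x y) pbr).
have Lu p : p \in x |: S -> uniq (L p).
  move=> pP; rewrite /L cat_uniq Fu //=; apply/andP; split.
    apply/hasPn => w wt; apply/negP => /= wF.
    have [q [qQ wH qE]] := tlH p w pP wt.
    have [pq wp pS] := meet p q w pP qQ wF wH.
    have px : p != x by apply: contraNneq xS => <-.
    move: wt; rewrite /tl (negPf px) wp; have := Hu p (SQ _ pS); have := Hw p (SQ _ pS).
    case: (H p) => //= b r /and3P[]; rewrite in_set1 => /eqP -> _ _ /andP[].
    by move/negPf ->.
  rewrite /tl; case: eqP pP => [_ _|/eqP px]; first by apply/Hu/setU11.
  rewrite in_setU1 (negPf px) => /SQ/Hu; case: (H p) => //= b r /andP[].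
  by [].
have Ld p q w : p \in x |: S -> q \in x |: S -> w \in L p -> w \in L q -> p = q.
  have mixed p' q' : p' \in x |: S ->
      q' \in x |: S -> w \in F p' -> w \in tl q' -> p' = q'.
    move=> pP qP wF /(tlH _ _ qP)[r [rQ wH rE]].
    have [pr _ pS] := meet _ _ _ pP rQ wF wH; move: rE; rewrite -pr.
    by case: eqP => // _ py; rewrite -py pS in yS.
  move=> pP qP; rewrite !mem_cat => /orP[wp|wp] /orP[wq|wq].
  - exact: Fd wp wq.
  - exact: mixed.
  - exact/esym/mixed.
  have [p' [p'Q wp' p'E]] := tlH _ _ pP wp; have [q' [q'Q wq' q'E]] := tlH _ _ qP wq.
  have pq' : p' = q' by apply: Hd wp' wq'.
  move: p'E q'E; rewrite pq'.
  case: (eqVneq p x) => [->|px]; case: (eqVneq q x) => [->|qx] // E1 E2.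
  - by move: qP; rewrite in_setU1 (negPf qx) -E2 E1 (negPf yS).
  - by move: pP; rewrite in_setU1 (negPf px) -E1 E2 (negPf yS).
  - by rewrite -E1.
pose idx i := enum_val (cast_ord (esym cP) i).
have idxP i : idx i \in x |: S by apply: enum_valP.
exists (fun i => L (idx i)); split=> [i|i|i j w wi wj]; [exact: Lw | exact: Lu |].
apply: (cast_ord_inj (eq_n := esym cP)); apply: enum_val_inj.
by apply: Ld wi wj; apply: idxP.
Qed.

(* Goering's proof, by deletion of an arc. *)
Theorem menger e A B k :
  (forall S, separates e A B S -> k <= #|S|) -> linked e A B k.
Proof.
elim/(@ltn_ind): {e}#|[set q : V * V | e q.1 q.2]| {-2}e
  (leqnn #|[set q : V * V | e q.1 q.2]|) A B => n IHn e en A B sepk.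
case: (pickP [pred q : V * V | e q.1 q.2]) => [[x y] /= exy|noe]; last first.
  (* Without arcs every walk is a single vertex, so [A :&: B] separates. *)
  have le : k <= #|A :&: B|.
    apply: sepk => -[|a [|b s]] //=; first by rewrite inE orbF.
    by have := noe (a, b) => /= ->; rewrite andbF.
  exists (fun i => [:: enum_val (widen_ord le i)]); split=> [i|i|i j x] //=.
    by have := enum_valP (widen_ord le i); rewrite inE => /andP[-> ->].
  rewrite !inE => /eqP -> /eqP/enum_val_inj E; apply: val_inj.
  by have := congr1 val E.
have ltd : #|[set q : V * V | del e x y q.1 q.2]| < n.
  apply: leq_trans en; apply: proper_card; apply/properP; split.
    by apply/subsetP => q; rewrite !inE => /andP[].
  by exists (x, y); rewrite inE // /del /= eqxx andbF.
have IH A' B' : (forall S, separates (del e x y) A' B' S -> k <= #|S|) ->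
    linked (del e x y) A' B' k by apply: IHn ltd _ (leqnn _) _ _.
case: (boolP [exists S : {set V}, (#|S| < k) &&
    [forall a in A :\: S, forall b in B, ~~ connect (induced (del e x y) (~: S)) a b]]).
  case/existsP=> S /andP[ltS /separatesP sepS].
  (* A walk avoiding [S] uses the deleted arc, so adding either end to [S] separates in [e]. By
     hypothesis both enlarged sets then have exactly [k] elements. *)
  have sepxy z : z \in [:: x; y] -> separates e A B (z |: S).
    move=> zxy p pw; apply/hasP; case: (boolP (has (mem S) p)) => [/hasP[c cp cS]|nS].
      by exists c; rewrite //= inE; apply/orP; right.
    have /andP[xp yp] := walk_uses_edge sepS pw nS.
    by move: zxy; rewrite !inE => /orP[]/eqP ->; [exists x | exists y];
      rewrite //= setU11.
  have card z : z \in [:: x; y] -> #|z |: S| = k.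
    move=> zxy; apply/eqP; rewrite eqn_leq sepk ?andbT; last exact: sepxy.
    by rewrite cardsU1; case: (z \notin S) => //=; lia.
  have xin : x \in [:: x; y] by rewrite mem_head.
  have yin : y \in [:: x; y] by rewrite !inE eqxx orbT.
  apply: (glue_walks exy sepS ltS (card x xin) (card y yin)); apply: IH => X sepX.
    apply: sepk => p pw.
    have [q qw qp] := walk_prefix y (setU11 x S) pw (sepxy x xin p pw).
    by have /hasP[c cq cX] := sepX q qw; apply/hasP; exists c => //; apply: qp.
  apply: sepk => p pw.
  have [q qw qp] := walk_suffix x (setU11 y S) pw (sepxy y yin p pw).
  by have /hasP[c cq cX] := sepX q qw; apply/hasP; exists c => //; apply: qp.
rewrite negb_exists => /forallP none; apply: (linked_subrel (@del_subrel e x y)).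
apply: IH => S /separatesP sepS; have := none S.
by rewrite sepS andbT -leqNgt.
Qed.

End Menger.

(** * Menger's theorem for two non-adjacent vertices *)

Lemma linked_disjoint_paths (G : sgraph) (u v : G) k : u != v -> ~~ edge u v ->
  linked (induced (@edge G) (~: [set u; v]))
    [set x | edge u x] [set x | edge v x] k ->
  has_disjoint_paths (@edge G) k u v.
Proof.
move=> uv nuv [f [fw fu fd]].
(* The first vertex is a neighbour of [u], hence not [u], and not [v] by non-adjacency; the later
   ones avoid both by the induced relation. *)
have fuv i x : x \in f i -> (x != u) && (x != v).
  move: (fw i); case: (f i) => // a s /= /and3P[ua pth _].
  have auv : (a != u) && (a != v).
    move: ua; rewrite inE => ua; apply/andP; split.
      by apply: contraTneq ua => ->; rewrite edge_irr.
    by apply: contraNneq nuv => <-.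
  elim: s a pth auv {ua} => [|b s IHs] a /=; first by rewrite inE => _ auv /eqP ->.
  case/andP=> /and3P[_ + _] bs auv; rewrite !inE negb_or => buv /orP[/eqP ->//|xs].
  exact: IHs bs buv _.
exists (fun i => rcons (f i) v); split=> [i|i j /rcons_inj[fij]|i j ij].
- split; last 1 first.
  + rewrite -rcons_cons rcons_uniq inE negb_or eq_sym uv /= fu andbT.
    apply/andP; split; first by apply/negP => /fuv; rewrite eqxx andbF.
    by apply/negP => /fuv; rewrite eqxx.
  + move: (fw i); case: (f i) => //= a s /and3P[]; rewrite !inE => ua pth va.
    rewrite ua rcons_path (sub_path _ pth) /=; last by move=> ? ? /and3P[].
    by rewrite edge_sym.
  + by rewrite last_rcons.
- move: (fw i) (fd i j); rewrite fij; case: (f j) => //= a s _ /(_ a).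
  by rewrite mem_head; apply.
- have inter l x : x \in interior u v (rcons (f l) v) -> x \in f l.
    rewrite inE in_cons mem_rcons inE.
    by case/andP=> /or3P[/eqP ->|/eqP ->|//]; rewrite eqxx ?andbF.
  rewrite disjoint_subset; apply/subsetP => x /inter xi; rewrite inE.
  by apply/negP => /inter xj; rewrite (fd i j x xi xj) eqxx in ij.
Qed.

(** Menger's theorem is applied between the neighbourhoods of [u] and [v]. From a small separator
    [S], the sides are the component [C] of [u] together with [S], and the complement of [C]. *)
Lemma disjoint_paths_or_separation (G : sgraph) (u v : G) k :
  u != v -> ~~ edge u v ->
  has_disjoint_paths (@edge G) k u v \/
  exists A B, [/\ separation A B, #|A :&: B| < k,
                  (u \in A) && (u \notin B) & (v \in B) && (v \notin A)].
Proof.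
move=> uv nuv; pose e' := induced (@edge G) (~: [set u; v]).
pose Nu := [set x | edge u x]; pose Nv := [set x | edge v x].
case: (boolP [exists S : {set G}, (#|S| < k) &&
  [forall a in Nu :\: S, forall b in Nv, ~~ connect (induced e' (~: S)) a b]]); last first.
  rewrite negb_exists => /forallP none; left; apply: linked_disjoint_paths => //.
  apply: menger => S /separatesP sepS; have := none S.
  by rewrite sepS andbT -leqNgt.
case/existsP=> S0 /andP[ltS0 /separatesP sepS0]; right.
pose S := S0 :\: [set u; v].
have ltS : #|S| < k by apply: leq_ltn_trans ltS0; apply/subset_leq_card/subsetDl.
have uS : u \notin S by rewrite !inE eqxx.
have vS : v \notin S by rewrite !inE eqxx orbT.
pose C := [set x | connect (induced (@edge G) (~: S)) u x].
have uC : u \in C by rewrite inE connect0.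
have SC x : x \in S -> x \notin C.
  move=> xS; rewrite inE; apply/negP => ux.
  have [||a [b [/and3P[_ bS _] _]]] := @connect_crossing _ _ (fun z => z \notin S) _ _ ux.
  - by [].
  - by rewrite negbK.
  by move: bS; rewrite inE => ->.
(* The interior of a simple path from [u] to [v] avoiding [S] would be a walk between the
   neighbourhoods, so it would meet [S0], outside [u] and [v] and thus in [S]. *)
have vC : v \notin C.
  rewrite inE; apply/negP => /connectP[p0 pth0 vE0].
  move: vE0; case: (shortenP pth0) => p pth up _ vE {p0 pth0}.
  case/lastP: p pth up vE => [|p w] pth up; first by move=> vu; rewrite vu eqxx in uv.
  rewrite last_rcons => vw; rewrite -{}vw {w} in pth up.
  have pS x : x \in p -> x \notin S.
    elim: p {up} (u) pth => //= b p IHp a /andP[/and3P[_ bS _] bp].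
    by rewrite inE => /orP[/eqP ->|]; [move: bS; rewrite inE | apply: IHp bp].
  have pe : path (@edge G) u (rcons p v) by apply: sub_path pth => ? ? /and3P[].
  move: up; rewrite -rcons_cons rcons_uniq inE negb_or => /andP[/andP[_ vp] /andP[up _]].
  have puv x : x \in p -> x \in ~: [set u; v].
    move=> xp; rewrite !inE negb_or; apply/andP; split.
      by apply: contraNneq up => <-.
    by apply: contraNneq vp => <-.
  have : has (mem S0) p.
    apply: sepS0; case: p pe puv {pth pS vp up} => [|a s] /=.
      by rewrite (negPf nuv).
    rewrite rcons_path => /and3P[ua pas lv] puv; rewrite !inE ua edge_sym lv andbT /=.
    elim: s a pas puv {ua lv} => //= b s IHs a /andP[ab bs] puv.
    rewrite {1}/e' /induced /= ab puv ?mem_head // puv; last by rewrite !inE eqxx orbT.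
    by apply: IHs => // x xs; apply: puv; rewrite in_cons xs orbT.
  case/hasP=> x xp /= xS0; have := puv x xp; rewrite in_setC => xuv.
  by have := pS x xp; rewrite in_setD xuv xS0.
exists (C :|: S), (~: C); split.
- apply/separationP; split.
    by move=> x; rewrite in_setU in_setC; case: (x \in C); [left | right].
  move=> a b _; rewrite !in_setC negbK => aC bC; rewrite in_setU negb_or => /andP[_ bS].
  apply/negP => ab; have aS : a \notin S by apply: contraL aC; apply: SC.
  case/negP: bC; move: aC; rewrite !inE => ua; apply: connect_trans ua _.
  by apply: connect1; rewrite /induced /= !in_setC aS bS ab.
- apply: leq_ltn_trans ltS; apply: subset_leq_card; apply/subsetP => x.
  by rewrite in_setI in_setU in_setC; case: (x \in C); rewrite ?andbF ?andbT.
- by rewrite in_setU in_setC uC.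
- by rewrite in_setU in_setC negb_or vC vS.
Qed.

Theorem theorem2p12 (G : sgraph) (k : nat) (hk : 3 <= k)
  (D : tree_decomposition G) (hD : atomic k D) (t : tree D) (u v : G)
  (hu : u \in bag t) (hv : v \in bag t)
  (huv : u != v) (hnadj : ~~ edge u v)
  (hdu : (2 * k - 2) * (k - 2) <= degree (torso t) u)
  (hdv : (2 * k - 2) * (k - 2) <= degree (torso t) v) :
  has_disjoint_paths (@edge G) k u v.
Proof.
have [//|[A [B [sepAB ltS /andP[uA uB] /andP[vB vA]]]]] :=
  disjoint_paths_or_separation k huv hnadj.
have [par [d rt]] := tree_rooted t (treeP D).
have k0 : 0 < k by lia.
(* The upper bound is [k * (k - 2)], and [k < 2 * k - 2] as soon as [k] is at least 3. *)
have big n : (2 * k - 2) * (k - 2) <= n -> n <= (k - 2) + (k - 1) * (k - 2) -> False.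
  by nia.
exfalso; case: (atomic_lean rt k0 hD sepAB ltS) => [ltA|ltB].
  by apply: big hdu _; apply: (torso_degree_le rt k0 hD sepAB ltS ltA hu uA uB).
rewrite separation_sym in sepAB; rewrite setIC in ltS.
by apply: big hdv _; apply: (torso_degree_le rt k0 hD sepAB ltS ltB hv vB vA).
Qed.
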